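(* Let $n\ge 2$ and let $X_1(t),\dots,X_n(t)$, $t\ge 0$, be independent Goldstein-Kac telegraph processes on $\mathbb{R}$ with speeds $c_k>0$, Poisson rates $\lambda_k>0$, starting points $x_k^0\in\mathbb{R}$ and direction processes $D_k(t)\in\{-1,+1\}$, $k=1,\dots,n$. Let $a_1,\dots,a_n$ be real non-zero constants and let $L(t)=\sum_{k=1}^n a_kX_k(t)$. For each sequence $\boldsymbol\sigma=\{i_1,\dots,i_n\}\in\{-1,+1\}^n$ let $f_{\boldsymbol\sigma}(x,t)$ be the joint probability density defined by $$f_{\boldsymbol\sigma}(x,t)\,dx=\Pr\{x<L(t)<x+dx,\ D_1(t)=i_1,\dots,D_n(t)=i_n\}.$$ Then the $2^n$ densities $f_{\boldsymbol\sigma}$, $\boldsymbol\sigma\in\{-1,+1\}^n$, satisfy, for $x\in\mathbb{R}$ and $t>0$, the following hyperbolic system of $2^n$ first-order partial differential equations with constant coefficients: $$\frac{\partial f_{\boldsymbol\sigma}(x,t)}{\partial t}=-\mathbf{c}_{\boldsymbol\sigma}\frac{\partial f_{\boldsymbol\sigma}(x,t)}{\partial x}-\boldsymbol\lambda f_{\boldsymbol\sigma}(x,t)+\sum_{k=1}^n\lambda_k\,f_{\bar{\boldsymbol\sigma}^{(k)}}(x,t),\qquad \boldsymbol\sigma\in\{-1,+1\}^n,$$ where, for $\boldsymbol\sigma=\{i_1,\dots,i_{k-1},i_k,i_{k+1},\dots,i_n\}$, one sets $\bar{\boldsymbol\sigma}^{(k)}=\{i_1,\dots,i_{k-1},-i_k,i_{k+1},\dots,i_n\}$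 and $$\mathbf{c}_{\boldsymbol\sigma}=\sum_{k=1}^n a_k i_k c_k,\qquad \boldsymbol\lambda=\sum_{k=1}^n\lambda_k.$$
   Context: Telegraph process: given $c>0$, $\lambda>0$, $x^0\in\mathbb{R}$, the Goldstein-Kac telegraph process with speed $c$, rate $\lambda$ and starting point $x^0$ is the position $X(t)$ of a particle that starts from $x^0$ at time $0$, picks an initial direction $D(0)\in\{-1,+1\}$ with probabilities $1/2$ each, moves with constant speed $c$, and instantaneously reverses direction at every event of a homogeneous Poisson process $N(t)$ of rate $\lambda$ independent of $D(0)$. Thus $D(t)=D(0)(-1)^{N(t)}$ is the direction at time $t$ ($+1$ for positive, $-1$ for negative) and $X(t)=x^0+c\int_0^t D(s)\,ds$. Independence of $X_1,\dots,X_n$ means that all the initial directions and all the governing Poisson processes $N_1,\dots,N_n$ are mutually independent. The distribution of $L(t)$ has a singular (atomic) component for each $t$, so $f_{\boldsymbol\sigma}(\cdot,t)$ is understood as a generalized function (tempered distribution): the density of the finite measure $B\mapsto\Pr\{L(t)\in B,\ D_1(t)=i_1,\dots,D_n(t)=i_n\}$ on $\mathbb{R}$. The differential equations are understood in the sense of generalized functions. A first-order system $\partial_t\mathbf{f}+C\,\partial_x\mathbf{f}+B\,\mathbf{f}=0$ with constant real matrices $C,B$ is called hyperbolic if $C$ is diagonalizable with real eigenvalues. *)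

(* Defs.v *)
From HB Require Import structures.
From mathcomp Require Import all_boot all_order all_algebra.
From mathcomp Require Import all_classical all_reals all_analysis.
Set Implicit Arguments.
Unset Strict Implicit.
Unset Printing Implicit Defensive.
Import Order.TTheory GRing.Theory Num.Theory.
Import numFieldNormedType.Exports.
Local Open Scope classical_set_scope.
Local Open Scope ring_scope.

Section Probability.
Context (d : measure_display) (T : measurableType d) (R : realType).
Variable P : probability T R.

Definition mutually_independent (I : finType) (F : I -> set (set T)) : Prop :=
  forall (J : {set I}) (A : I -> set T), (forall i, i \in J -> F i (A i)) ->
    P (\bigcap_(i in [set` J]) A i) = (\prod_(i in J) P (A i))%E.

Definition sigma_rv (d' : measure_display) (T' : measurableType d')
    (Y : T -> T') : set (set T) :=
  preimage_set_system setT Y measurable.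

(* Times are real numbers; only times t >= 0 are meaningful. *)
Definition sigma_process (d' : measure_display) (T' : measurableType d')
    (Y : R -> T -> T') : set (set T) :=
  <<s [set A | exists2 t : R, 0 <= t & sigma_rv (Y t) A] >>.

(* The subtraction on nat is exact in increments, since the paths are
   nondecreasing. *)
Record poisson_process (lam : R) (N : R -> T -> nat) : Prop := {
  poisson_measurable : forall t, 0 <= t -> measurable_fun setT (N t);
  poisson_start : forall w, N 0 w = 0%N;
  poisson_nondecreasing : forall w s t, 0 <= s -> s <= t ->
    (N s w <= N t w)%N;
  poisson_right_continuous : forall w t, 0 <= t ->
    \forall s \near t^'+, N s w = N t w;
  poisson_increment_law : forall s t, 0 <= s -> s < t -> forall j : nat,
    P [set w | (N t w - N s w)%N = j] = (poisson_pmf (lam * (t - s)) j)%:E;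
  poisson_independent_increments : forall (m : nat) (tau : nat -> R),
    0 <= tau 0%N -> (forall i, tau i <= tau i.+1) ->
    mutually_independent (fun i : 'I_m =>
      sigma_rv (fun w => (N (tau i.+1) w - N (tau i) w)%N)) }.

Record goldstein_kac (c lam x0 : R) (D0 : T -> R) (N : R -> T -> nat)
    (D X : R -> T -> R) : Prop := {
  gk_speed_gt0 : 0 < c;
  gk_rate_gt0 : 0 < lam;
  gk_D0_measurable : measurable_fun setT (D0 : T -> measurableTypeR R);
  gk_D0_values : forall w, D0 w = 1 \/ D0 w = -1;
  gk_D0_pos : P [set w | D0 w = 1] = (2^-1)%:E;
  gk_D0_neg : P [set w | D0 w = -1] = (2^-1)%:E;
  gk_poisson : poisson_process lam N;
  gk_independent : mutually_independent (fun b : bool =>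
    if b then sigma_rv (D0 : T -> measurableTypeR R) else sigma_process N);
  gk_direction : forall t w, 0 <= t -> D t w = D0 w * (-1) ^+ N t w;
  gk_position : forall t w, 0 <= t ->
    X t w = x0 + c * \int[lebesgue_measure]_(s in `[0, t]) D s w }.

Definition independent_telegraphs (n : nat) (D0 : 'I_n -> T -> R)
    (N : 'I_n -> R -> T -> nat) : Prop :=
  mutually_independent (fun s : 'I_n + 'I_n =>
    match s with
    | inl k => sigma_rv (D0 k : T -> measurableTypeR R)
    | inr k => sigma_process (N k)
    end).

End Probability.

(* A sequence in {-1,+1}^n is coded by booleans: [false] stands for +1 and
   [true] for -1. *)
Definition signs (n : nat) := {ffun 'I_n -> bool}.

Definition sgn_at (R : realType) (n : nat) (sigma : signs n) (k : 'I_n) : R :=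
  (-1) ^+ sigma k.

Definition flip (n : nat) (sigma : signs n) (k : 'I_n) : signs n :=
  [ffun j => if j == k then ~~ sigma j else sigma j].

Section GeneralizedFunctions.
Context (R : realType).

Definition schwartz (phi : R -> R) : Prop :=
  (forall (k : nat) (x : R), derivable (derive1n k phi) x 1) /\
  (forall m k : nat, exists M : R, forall x : R,
     `|x| ^+ m * `|derive1n k phi x| <= M).

(* A generalized function in x is given by its pairing with test functions;
   only its values on Schwartz functions are meaningful.  Real test functions
   suffice, since all measures and coefficients are real. *)
Definition genfun := (R -> R) -> R.

Definition genfun_of_measure
    (mu : set (measurableTypeR R) -> \bar R) : genfun :=
  fun phi => fine (\int[mu]_x (phi x)%:E)%E.

Definition dx (u : genfun) : genfun := fun phi => - u (derive1 phi).

(* [v] is the derivative at time [t] of the family [u] of generalized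
   functions, for the weak-* topology of the space of tempered distributions. *)
Definition is_dt (u : R -> genfun) (t : R) (v : genfun) : Prop :=
  forall phi, schwartz phi -> is_derive t 1 (fun s => u s phi) (v phi).

(* u_t + C u_x + B u = 0 for t > 0 *)
Definition first_order_system (m : nat) (C B : 'M[R]_m)
    (u : 'I_m -> R -> genfun) : Prop :=
  forall (i : 'I_m) (t : R), 0 < t ->
    is_dt (u i) t (fun phi =>
      - (\sum_(j < m) C i j * dx (u j t) phi)
      - \sum_(j < m) B i j * u j t phi).

(* Diagonalizability is over the real field R, so the eigenvalues are real. *)
Definition hyperbolic (m : nat) (C : 'M[R]_m) : Prop := diagonalizable C.

End GeneralizedFunctions.

Section TelegraphSystem.
Context (R : realType) (n : nat).

Definition joint_law (d : measure_display) (T : measurableType d)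
    (P : probability T R) (a : 'I_n -> R) (X D : 'I_n -> R -> T -> R)
    (sigma : signs n) (t : R) : set (measurableTypeR R) -> \bar R :=
  fun B => P [set w | B (\sum_(k < n) a k * X k t w) /\
                      forall k, D k t w = sgn_at R sigma k].

Definition joint_density (d : measure_display) (T : measurableType d)
    (P : probability T R) (a : 'I_n -> R) (X D : 'I_n -> R -> T -> R)
    (sigma : signs n) (t : R) : genfun R :=
  genfun_of_measure (joint_law P a X D sigma t).

Variables a c lam : 'I_n -> R.

Definition c_sigma (sigma : signs n) : R :=
  \sum_(k < n) a k * sgn_at R sigma k * c k.

Definition lam_total : R := \sum_(k < n) lam k.

Definition telegraph_system (f : signs n -> R -> genfun R) : Prop :=
  forall (sigma : signs n) (t : R), 0 < t ->
    is_dt (f sigma) t (fun phi =>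
      - c_sigma sigma * dx (f sigma t) phi
      - lam_total * f sigma t phi
      + \sum_(k < n) lam k * f (flip sigma k) t phi).

(* Rows and columns are indexed by an enumeration of {-1,+1}^n. *)
Definition transport_mx : 'M[R]_#|{: signs n}| :=
  \matrix_(i, j) (c_sigma (enum_val i) *+ (i == j)).

Definition switching_mx : 'M[R]_#|{: signs n}| :=
  \matrix_(i, j) (lam_total *+ (i == j)
    - \sum_(k < n) lam k *+ (flip (enum_val i) k == enum_val j)).

End TelegraphSystem.

(* Main.v *)
Require Import Defs.
From HB Require Import structures.
From mathcomp Require Import all_boot all_order all_algebra.
From mathcomp Require Import all_classical all_reals all_analysis.
From mathcomp Require Import measurable_realfun ring lra.
Set Implicit Arguments.
Unset Strict Implicit.
Unset Printing Implicit Defensive.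
Import Order.TTheory GRing.Theory Num.Theory.
Import numFieldNormedType.Exports.
Local Open Scope classical_set_scope.
Local Open Scope ring_scope.

(** The pair (L, D_1, ..., D_n) is a Markov process, and the system is its
    forward Kolmogorov equation tested against functions of the position.
    Testing against a Schwartz function phi turns the density f_sigma(., t)
    into the number g_sigma(t) = E[phi(L(t)); D(t) = sigma] ([pairing],
    [joint_density_pairing]), so only the time derivative of
    these expectations is needed.

    Fix s < t, put h = t - s, and let Lam be the sum of the rates.
    - With probability exp(- Lam h) no process switches on (s, t]; the
      directions are then frozen and L moves by exactly c_sigma h, which a
      first-order Taylor expansion of phi turns into the transport term.
    - With probability lam_k h exp(- Lam h) only the k-th process switches, and
      exactly once; then D(t) = sigma means that D(s) is sigma with its k-th
      sign flipped, and L moves by O(h).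
    - Everything else has probability O(h^2).
    Since the switches on (s, t] are independent of (L(s), D(s)), taking
    expectations gives g(t) - g(s) = h G(s) + O(h^2) ([generator_estimate]),
    where G is the right-hand side of the system and the constant is uniform in
    s and t.  Uniformity matters: applied to phi and to phi' it shows that G is
    Lipschitz, so G(s) may be replaced by G(t) and the one-sided estimate
    yields the two-sided derivative ([is_derive_quadratic]).

    The independence of (L(s), D(s)) from the later switches
    ([mean_state_jump_event]) is reduced to finitely many variables: L(s) is the
    limit of its Riemann sums, each of which is a function of finitely many
    signs: the initial directions and the parities of the increments of the
    Poisson processes over a grid of [0, s].  For events of this finite kind
    independence is a rearrangement of products of probabilities, and dominated
    convergence passes to the limit.

    The remaining claims are algebra: the transport matrix is diagonal, and
    enumerating {-1,+1}^n turns one form of the system into the other. *)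

(** * Expectations of bounded random variables *)

Section BoundedRandomVariables.
Context (d : measure_display) (T : measurableType d) (R : realType).
Variable P : probability T R.
Implicit Types (f g : T -> R) (A : set T).

Definition bounded_rv f :=
  measurable_fun setT f /\ exists M, forall w, `|f w| <= M.

Lemma bounded_rv_integrable f : bounded_rv f -> P.-integrable setT (EFin \o f).
Proof.
move=> [mf [M fM]]; apply: measurable_bounded_integrable => //.
  exact: (le_lt_trans (probability_le1 P measurableT) (ltry 1)).
by exists M; split; [exact: num_real|move=> x Mx w _ /=; exact: le_trans (fM w) (ltW Mx)].
Qed.

Lemma bounded_rv_cst r : bounded_rv (fun=> r).
Proof. by split=> //; exists `|r|. Qed.

Lemma bounded_rvD f g : bounded_rv f -> bounded_rv g ->
  bounded_rv (fun w => f w + g w).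
Proof.
move=> [mf [M fM]] [mg [K gK]]; split; first exact: measurable_funD.
by exists (M + K) => w; apply: le_trans (ler_normD _ _) (lerD _ _).
Qed.

Lemma bounded_rvM f g : bounded_rv f -> bounded_rv g ->
  bounded_rv (fun w => f w * g w).
Proof.
move=> [mf [M fM]] [mg [K gK]]; split; first exact: measurable_funM.
by exists (M * K) => w; rewrite normrM ler_pM.
Qed.

Lemma bounded_rvZ r f : bounded_rv f -> bounded_rv (fun w => r * f w).
Proof. by apply: bounded_rvM; exact: bounded_rv_cst. Qed.

Lemma bounded_rvB f g : bounded_rv f -> bounded_rv g ->
  bounded_rv (fun w => f w - g w).
Proof.
move=> bf bg; under eq_fun do rewrite -[- g _]mulN1r.
by apply: bounded_rvD => //; exact: bounded_rvZ.
Qed.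

Lemma bounded_rv_norm f : bounded_rv f -> bounded_rv (fun w => `|f w|).
Proof.
move=> [mf [M fM]]; split; first exact: measurableT_comp.
by exists M => w; rewrite normr_id.
Qed.

Lemma bounded_rv_sum (I : Type) (s : seq I) (F : I -> T -> R) :
  (forall i, bounded_rv (F i)) -> bounded_rv (fun w => \sum_(i <- s) F i w).
Proof.
move=> bF; elim: s => [|i s IH].
  by under eq_fun do rewrite big_nil; exact: bounded_rv_cst.
by under eq_fun do rewrite big_cons; exact: bounded_rvD.
Qed.

Lemma bounded_rv_indic A : measurable A -> bounded_rv (\1_A : T -> R).
Proof.
move=> mA; split; first exact: measurable_indic.
by exists 1 => w; rewrite indicE ger0_norm ?ler0n // lern1 leq_b1.
Qed.

Lemma meanD f g : bounded_rv f -> bounded_rv g ->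
  \int[P]_w (f w + g w) = \int[P]_w f w + \int[P]_w g w.
Proof. by move=> bf bg; rewrite RintegralD //; exact: bounded_rv_integrable. Qed.

Lemma meanB f g : bounded_rv f -> bounded_rv g ->
  \int[P]_w (f w - g w) = \int[P]_w f w - \int[P]_w g w.
Proof. by move=> bf bg; rewrite RintegralB //; exact: bounded_rv_integrable. Qed.

Lemma meanZ r f : bounded_rv f -> \int[P]_w (r * f w) = r * \int[P]_w f w.
Proof. by move=> bf; rewrite RintegralZl //; exact: bounded_rv_integrable. Qed.

Lemma mean_sum (I : Type) (s : seq I) (F : I -> T -> R) :
  (forall i, bounded_rv (F i)) ->
  \int[P]_w (\sum_(i <- s) F i w) = \sum_(i <- s) \int[P]_w F i w.
Proof.
move=> bF; elim: s => [|i s IH].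
  rewrite big_nil; under eq_Rintegral do rewrite big_nil.
  by rewrite Rintegral_cst // mul0r.
under eq_Rintegral do rewrite big_cons.
by rewrite meanD // ?IH ?big_cons //; exact: bounded_rv_sum.
Qed.

Lemma mean_indic A : measurable A -> \int[P]_w \1_A w = fine (P A).
Proof. by move=> mA; rewrite /Rintegral integral_indic // setIT. Qed.

Lemma le_mean f g : bounded_rv f -> bounded_rv g -> (forall w, f w <= g w) ->
  \int[P]_w f w <= \int[P]_w g w.
Proof. by move=> bf bg fg; apply: le_Rintegral => //; exact: bounded_rv_integrable. Qed.

Lemma le_norm_mean f g : bounded_rv f -> bounded_rv g ->
  (forall w, `|f w| <= g w) -> `|\int[P]_w f w| <= \int[P]_w g w.
Proof.
move=> bf bg fg; apply: (@le_trans _ _ (\int[P]_w `|f w|)).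
  by apply: le_normr_Rintegral => //; exact: bounded_rv_integrable.
by apply: le_mean => //; exact: bounded_rv_norm.
Qed.

Lemma mean_cst r : \int[P]_w r = r :> R.
Proof.
rewrite Rintegral_cst // -[RHS]mulr1; congr (_ * _).
by rewrite [X in fine X](probability_setT P).
Qed.

Lemma norm_mean_le f M : bounded_rv f -> (forall w, `|f w| <= M) ->
  `|\int[P]_w f w| <= M.
Proof.
move=> bf fM; rewrite -[leRHS]mean_cst; apply: le_norm_mean => //.
exact: bounded_rv_cst.
Qed.

Lemma mean_cvg (f_ : nat -> T -> R) f M :
  (forall m, measurable_fun setT (f_ m)) -> (forall m w, `|f_ m w| <= M) ->
  (forall w, f_ ^~ w @ \oo --> f w) ->
  \int[P]_w f_ m w @[m --> \oo] --> \int[P]_w f w.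
Proof.
move=> mf_ f_M f_f.
have mf : measurable_fun setT f by apply: measurable_fun_cvg mf_ _ => w _; exact: f_f.
have [] := @dominated_convergence _ _ _ P setT measurableT
  (fun m => EFin \o f_ m) (EFin \o f) (fun=> M%:E).
- by move=> m; exact/measurable_EFinP.
- exact/measurable_EFinP.
- by apply: aeW => w _; apply: cvg_EFin; [exact: nearW|exact: f_f].
- by have := bounded_rv_integrable (bounded_rv_cst M).
- by apply: aeW => w m _ /=; rewrite lee_fin.
move=> intf _ cvgf; apply: fine_cvg; rewrite fineK; last first.
  exact: integrable_fin_num.
exact: cvgf.
Qed.

(** A joint law is the image of the restriction of [P] to an event; this brings
    integrals against it back to expectations.  The complement of [A] is null
    for the restricted measure, and on [A] both measures agree. *)
Lemma integral_mrestr A (mA : measurable A) f : bounded_rv f ->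
  (\int[mrestr P mA]_w (f w)%:E = (\int[P]_w (f w * \1_A w))%:E)%E.
Proof.
move=> bf; have bfA := bounded_rvM bf (bounded_rv_indic mA).
rewrite (@negligible_integral _ _ _ _ setT (~` A)) //.
- rewrite setTD setCK (eq_measure_integral P); last first.
    by move=> B mB BA; rewrite /= /mrestr setIidl.
  rewrite /Rintegral fineK; last first.
    by apply: integrable_fin_num => //; exact: bounded_rv_integrable.
  rewrite integral_mkcond; apply: eq_integral => w _.
  by rewrite patchE indicE; case: (w \in A); rewrite ?mulr1 ?mulr0.
- exact: measurableC.
- case: bf => mf [M fM]; apply: measurable_bounded_integrable => //.
    rewrite /= /mrestr setTI; exact: le_lt_trans (probability_le1 _ mA) (ltry 1).
  by exists M; split; [exact: num_real|move=> x Mx w _ /=; exact: le_trans (fM w) (ltW Mx)].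
- by rewrite /= /mrestr setICl measure0.
Qed.

End BoundedRandomVariables.

(** * Paths of a telegraph process *)

(** Its level sets are intervals. *)
Lemma measurable_nondecreasing_nat (R : realType) (N : R -> nat) :
  (forall s t, s <= t -> (N s <= N t)%N) -> measurable_fun setT N.
Proof.
move=> homoN _ Y _; rewrite setTI.
rewrite (_ : N @^-1` Y = \bigcup_(j in Y) (N @^-1` [set j])); last first.
  by apply/seteqP; split=> [s Ys|s [j Yj Ns]]; [exists (N s)|rewrite /preimage /= Ns].
apply: bigcup_measurable => j _; apply: is_interval_measurable.
move=> s t /= Ns Nt u /andP[su ut]; apply/eqP.
by rewrite eqn_leq -[X in (_ <= X)%N && _]Nt -[X in _ && (X <= _)%N]Ns !homoN.
Qed.

Section TelegraphPath.
Context (d : measure_display) (T : measurableType d) (R : realType).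
Variable P : probability T R.
Variables (c lam x0 : R) (D0 : T -> R) (N : R -> T -> nat) (D X : R -> T -> R).
Hypothesis gk : goldstein_kac P c lam x0 D0 N D X.

(** The direction process is only controlled at nonnegative times; freezing it
    at time 0 on the left makes it measurable on the whole line. *)
Let DE (w : T) (s : R) : R := D0 w * (-1) ^+ N (Order.max 0 s) w.

Let DE_eq w s : 0 <= s -> D s w = DE w s.
Proof. by move=> s0; rewrite (gk_direction gk) // /DE max_r. Qed.

Lemma norm_direction w t : 0 <= t -> `|D t w| = 1.
Proof.
move=> t0; rewrite (gk_direction gk) // normrM normrX normrN1 expr1n mulr1.
by case: (gk_D0_values gk w) => ->; rewrite ?normrN normr1.
Qed.

Let norm_DE w s : `|DE w s| = 1.
Proof.
have m0 : 0 <= Order.max 0 s by rewrite le_max lexx.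
by rewrite -(norm_direction w m0) (gk_direction gk).
Qed.

Let mDE w : measurable_fun setT (DE w).
Proof.
have mN : measurable_fun setT (fun s : R => N (Order.max 0 s) w).
  apply: measurable_nondecreasing_nat => s t st.
  apply: (poisson_nondecreasing (gk_poisson gk)); first by rewrite le_max lexx.
  by rewrite ge_max !le_max lexx st orbT.
by apply: (@measurableT_comp _ _ _ _ _ _ (fun j : nat => D0 w * (-1) ^+ j)).
Qed.

Let intDE w (i : interval R) : (lebesgue_measure [set` i] < +oo)%E ->
  lebesgue_measure.-integrable [set` i] (EFin \o DE w).
Proof.
move=> fi; apply: measurable_bounded_integrable => //.
  exact: measurable_funTS (mDE w).
exists 1; split; first exact: num_real.
by move=> x x1 s _ /=; rewrite norm_DE ltW.
Qed.

Let length_oc (s t : R) : s <= t -> lebesgue_measure `]s, t] = (t - s)%:E.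
Proof.
rewrite le_eqVlt => /predU1P[->|st]; rewrite lebesgue_measure_itv /= lte_fin.
  by rewrite ltxx subrr.
by rewrite st EFinB.
Qed.

Let integral_oc_cst (s t r : R) : s <= t ->
  \int[lebesgue_measure]_(u in `]s, t]) r = r * (t - s).
Proof.
move=> st; rewrite Rintegral_cst //; congr (_ * _).
exact: (congr1 fine (length_oc st)).
Qed.

Lemma position_increment w s t : 0 <= s -> s <= t ->
  X t w - X s w = c * \int[lebesgue_measure]_(u in `]s, t]) DE w u.
Proof.
move=> s0 st; have t0 := le_trans s0 st.
rewrite !(gk_position gk) // opprD addrACA subrr add0r -mulrBr; congr (_ * _).
have toDE r : 0 <= r -> \int[lebesgue_measure]_(u in `[0, r]) D u w =
    \int[lebesgue_measure]_(u in `[0, r]) DE w u.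
  move=> r0; apply: eq_Rintegral => u; rewrite inE /= in_itv /= => /andP[u0 _].
  exact: DE_eq.
rewrite !toDE // Rintegral_itvB //.
apply: intDE; rewrite lebesgue_measure_itv /=; case: ifP => _; exact: ltry.
Qed.

Lemma position0 w : X 0 w = x0.
Proof.
by rewrite (gk_position gk) // set_itv1 Rintegral_set1 mulr0 addr0.
Qed.

Lemma position_lipschitz w s t : 0 <= s -> s <= t ->
  `|X t w - X s w| <= c * (t - s).
Proof.
move=> s0 st; rewrite position_increment // normrM gtr0_norm ?(gk_speed_gt0 gk) //.
rewrite ler_pM2l ?(gk_speed_gt0 gk) //.
have iDE : lebesgue_measure.-integrable `]s, t] (EFin \o DE w).
  by apply: intDE; rewrite length_oc // ltry.
apply: le_trans (le_normr_Rintegral _ iDE) _ => //.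
under eq_Rintegral do rewrite norm_DE.
by rewrite integral_oc_cst // mul1r.
Qed.

Lemma position_no_switch w s t : 0 <= s -> s <= t -> N t w = N s w ->
  X t w - X s w = c * (t - s) * D s w.
Proof.
move=> s0 st Nst; rewrite position_increment // -mulrA; congr (_ * _).
rewrite (@eq_Rintegral _ _ _ _ _ (fun=> D s w)); last first.
  move=> u; rewrite inE /= in_itv /= => /andP[su ut].
  have u0 := le_trans s0 (ltW su); rewrite -DE_eq // !(gk_direction gk) //.
  congr (_ * _ ^+ _); apply/eqP; rewrite eqn_leq -{1}Nst.
  by rewrite !(poisson_nondecreasing (gk_poisson gk)) // ltW.
by rewrite integral_oc_cst // mulrC.
Qed.

(** The error vanishes unless the interval contains a switch, so over a grid
    the errors add up to at most the mesh times the total number of switches: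
    this is what makes the Riemann sums converge at every path. *)
Lemma position_increment_error w s t : 0 <= s -> s <= t ->
  `|X t w - X s w - c * (t - s) * D s w|
    <= 2 * c * (t - s) * (N t w - N s w)%:R.
Proof.
move=> s0 st; have c0 := gk_speed_gt0 gk.
have := poisson_nondecreasing (gk_poisson gk) w s0 st.
rewrite leq_eqVlt => /predU1P[Nst|Nst].
  by rewrite position_no_switch // subrr normr0 Nst subnn mulr0.
apply: le_trans (ler_normB _ _) _.
rewrite [X in _ + X]normrM norm_direction // mulr1 [X in _ + X]ger0_norm; last first.
  by rewrite mulr_ge0 ?subr_ge0 // ltW.
apply: le_trans (lerD (position_lipschitz w s0 st) (lexx _)) _.
rewrite -mulr2n -[X in X <= _]mulr_natl mulrA ler_peMr //.
  by rewrite !mulr_ge0 ?subr_ge0 // ltW.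
by rewrite ler1n subn_gt0.
Qed.

Definition riemann_position (s : R) (m : nat) (w : T) : R :=
  x0 + c * (s / m.+1%:R) * \sum_(i < m.+1) D (s * i%:R / m.+1%:R) w.

Lemma riemann_position_error s m w : 0 <= s ->
  `|X s w - riemann_position s m w| <= 2 * c * s * (N s w)%:R / m.+1%:R.
Proof.
move=> s0; pose tau i : R := s * i%:R / m.+1%:R.
have tau0 i : 0 <= tau i by rewrite /tau !mulr_ge0 ?ler0n // invr_ge0 ler0n.
have dtau i : tau i.+1 - tau i = s / m.+1%:R.
  by rewrite /tau -!mulrA -mulrBr -mulrBl -natrB // subSnn mul1r.
have taule i : tau i <= tau i.+1.
  by rewrite -subr_ge0 dtau divr_ge0 ?ler0n.
have tau_0 : tau 0%N = 0 by rewrite /tau mulr0 mul0r.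
have tau_m : tau m.+1 = s by rewrite /tau mulfK // pnatr_eq0.
have -> : X s w - riemann_position s m w = \sum_(i < m.+1)
    (X (tau i.+1) w - X (tau i) w - c * (tau i.+1 - tau i) * D (tau i) w).
  rewrite sumrB /riemann_position opprD addrA; congr (_ - _).
    rewrite -(big_mkord xpredT (fun i => X (tau i.+1) w - X (tau i) w)).
    by rewrite telescope_sumr // tau_m tau_0 position0.
  by rewrite mulr_sumr; apply: eq_bigr => i _; rewrite dtau.
apply: le_trans (ler_norm_sum _ _ _) _.
apply: (@le_trans _ _ (\sum_(i < m.+1)
    2 * c * (s / m.+1%:R) * ((N (tau i.+1) w)%:R - (N (tau i) w)%:R))).
  apply: ler_sum => i _; rewrite -(dtau i) -natrB.
    exact: position_increment_error.
  exact: (poisson_nondecreasing (gk_poisson gk)).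
rewrite -mulr_sumr.
rewrite -(big_mkord xpredT (fun i => (N (tau i.+1) w)%:R - (N (tau i) w)%:R)).
rewrite telescope_sumr // tau_m tau_0 (poisson_start (gk_poisson gk)) subr0.
by rewrite le_eqVlt; apply/orP; left; apply/eqP; ring.
Qed.

Lemma riemann_position_cvg s w : 0 <= s ->
  riemann_position s m w @[m --> \oo] --> X s w.
Proof.
move=> s0; apply/cvgrPdist_le => e e0.
have : 2 * c * s * (N s w)%:R / m.+1%:R @[m --> \oo] --> (0 : R).
  rewrite -(mulr0 (2 * c * s * (N s w)%:R)); apply: cvgM; first exact: cvg_cst.
  exact: cvg_harmonic.
move/cvgrPdist_le => /(_ _ e0); apply: filterS => m.
rewrite sub0r normrN => /(le_trans (ler_norm _)).
exact: le_trans (riemann_position_error m w s0).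
Qed.

Lemma measurable_direction t : 0 <= t -> measurable_fun setT (D t).
Proof.
move=> t0; rewrite (_ : D t = fun w => D0 w * (-1) ^+ N t w); last first.
  by apply/funext => w; exact: (gk_direction gk).
apply: measurable_funM; first exact: (gk_D0_measurable gk).
apply: (@measurableT_comp _ _ _ _ _ _ (fun j : nat => (-1) ^+ j : R)) => //.
exact: (poisson_measurable (gk_poisson gk)).
Qed.

Lemma measurable_riemann_position s m : 0 <= s ->
  measurable_fun setT (riemann_position s m).
Proof.
move=> s0; apply: measurable_funD => //; apply: measurable_funM => //.
apply: measurable_sum => i; apply: measurable_direction.
by rewrite !mulr_ge0 ?ler0n // invr_ge0 ler0n.
Qed.

(** The position is a time integral of a random path, so its measurability in
    the sample point is not immediate; the Riemann sums provide it. *)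
Lemma measurable_position s : 0 <= s -> measurable_fun setT (X s).
Proof.
move=> s0; apply: (measurable_fun_cvg (fun m => measurable_riemann_position m s0)).
by move=> w _; exact: riemann_position_cvg.
Qed.

End TelegraphPath.

(** * Independence of the past and the future switches *)

Section FiniteFamilies.
Context (d : measure_display) (T : measurableType d) (R : realType).
Variable P : probability T R.

Lemma measurable_forall (I : finType) (F : I -> set T) :
  (forall i, measurable (F i)) -> measurable [set w | forall i, F i w].
Proof.
move=> mF; rewrite (_ : [set _ | _] = \bigcap_(i in setT) F i); last first.
  by apply/seteqP; split=> w Fw i //; exact: Fw.
by apply: fin_bigcap_measurable => // i _.
Qed.

Lemma mutually_independentT (I : finType) (G : I -> set (set T))
    (A : I -> set T) : mutually_independent P G -> (forall i, G i (A i)) ->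
  P [set w | forall i, A i w] = (\prod_i P (A i))%E.
Proof.
move=> indG GA; have := indG [set: I]%SET A (fun i _ => GA i).
rewrite (eq_bigl xpredT) => [<-|i]; last by rewrite inE.
congr (P _); apply/seteqP; split=> w Aw i; first by move=> _; exact: Aw.
by apply: Aw => /=; rewrite inE.
Qed.

Lemma sigma_rv_preimage (d' : measure_display) (T' : measurableType d')
    (Y : T -> T') (B : set T') : measurable B ->
  sigma_rv Y [set w | B (Y w)].
Proof. by move=> mB; exists B => //; rewrite setTI. Qed.

(** For a finite-valued map, independence of its level sets from an event is
    enough: every function of it is a finite combination of their
    indicators. *)
Lemma mean_indep_finite (V : finType) (f : T -> V) (F : set T) :
  measurable F -> (forall v, measurable [set w | f w = v]) ->
  (forall v, P ([set w | f w = v] `&` F) = P [set w | f w = v] * P F)%E ->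
  forall G : V -> R, \int[P]_w (G (f w) * \1_F w) =
    \int[P]_w G (f w) * fine (P F).
Proof.
move=> mF mf indF G; pose E v := [set w | f w = v].
have GE w : G (f w) = \sum_v G v * \1_(E v) w.
  rewrite (bigD1 (f w)) //= indicE mem_set // mulr1 big1 ?addr0 // => v vw.
  by rewrite indicE memNset ?mulr0 // => /esym /eqP; rewrite (negbTE vw).
under eq_Rintegral => w _ do rewrite GE mulr_suml.
under [in RHS]eq_Rintegral => w _ do rewrite GE.
have bE A v : measurable A -> bounded_rv (fun w => G v * \1_A w : R).
  by move=> mA; apply: bounded_rvZ; exact: bounded_rv_indic.
rewrite mean_sum => [|v]; last first.
  by apply: bounded_rvM; [exact: bE (mf v)|exact: bounded_rv_indic].
rewrite mean_sum => [|v]; last exact: bE (mf v).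
rewrite mulr_suml; apply: eq_bigr => v _.
under eq_Rintegral => w _ do rewrite -mulrA.
have mEv : measurable (E v) by exact: mf.
have bEv : bounded_rv (\1_(E v) : T -> R) by exact: bounded_rv_indic (mf v).
rewrite meanZ; last by apply: bounded_rvM => //; exact: bounded_rv_indic.
rewrite [in RHS]meanZ //.
rewrite -[RHS]mulrA; congr (_ * _).
under eq_Rintegral => w _ do rewrite -[_ * _]/((\1_(E v) \* \1_F) w) -indicI.
have mEF : measurable (E v `&` F) by exact: measurableI.
by rewrite !mean_indic // indF fineM ?fin_num_measure.
Qed.

End FiniteFamilies.

Section Independence.
Context (d : measure_display) (T : measurableType d) (R : realType).
Variable P : probability T R.
Variables (n : nat) (c lam x0 a : 'I_n -> R).
Variables (D0 : 'I_n -> T -> R) (N : 'I_n -> R -> T -> nat).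
Variables (D X : 'I_n -> R -> T -> R).
Hypothesis gk :
  forall k, goldstein_kac P (c k) (lam k) (x0 k) (D0 k) (N k) (D k) (X k).
Hypothesis indep : independent_telegraphs P D0 N.

Lemma measurable_increment k (s t : R) (Q : set nat) : 0 <= s -> 0 <= t ->
  measurable [set w | Q (N k t w - N k s w)%N].
Proof.
move=> s0 t0; rewrite -[X in measurable X]setTI.
have pN := gk_poisson (gk k).
by apply: (measurable_fun_subn (poisson_measurable pN t0)
  (poisson_measurable pN s0)).
Qed.

(** Independence across the processes is assumed for the sigma-algebras they
    generate, so the events used below must be shown to lie in these and not
    merely to be measurable. *)
Lemma sigma_process_increments k (I : finType) (s t : I -> R) (Q : I -> set nat) :
  (forall i, 0 <= s i) -> (forall i, 0 <= t i) ->
  sigma_process (N k) [set w | forall i, Q i (N k (t i) w - N k (s i) w)%N].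
Proof.
move=> s0 t0.
pose G := [set A | exists2 t : R, 0 <= t & sigma_rv (N k t) A].
have mN r : 0 <= r -> measurable_fun setT (N k r : g_sigma_algebraType G -> nat).
  move=> r0 _ B mB; rewrite setTI; apply: sub_sigma_algebra.
  by exists r => //; exact: sigma_rv_preimage.
apply: (@measurable_forall _ (g_sigma_algebraType G)) => i.
rewrite -[X in measurable X]setTI.
by apply: (measurable_fun_subn (mN _ (t0 i)) (mN _ (s0 i))).
Qed.

Section Grid.
Variables (s t : R) (m : nat).
Hypotheses (s0 : 0 <= s) (st : s < t).

(** The [m.+1] equal steps of [0, s] followed by the single step (s, t], so
    that the independence of the increments over the grid also separates the
    past from (s, t]. *)
Definition grid (i : nat) : R :=
  if (i <= m.+1)%N then s * i%:R / m.+1%:R else t.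

Let grid_ge0 i : 0 <= grid i.
Proof.
rewrite /grid; case: ifP => _; last exact: le_trans s0 (ltW st).
by rewrite !mulr_ge0 ?ler0n // invr_ge0 ler0n.
Qed.

Let grid_end : grid m.+1 = s.
Proof. by rewrite /grid leqnn mulfK // pnatr_eq0. Qed.

Let grid_next : grid m.+2 = t.
Proof. by rewrite /grid ltnn. Qed.

Let grid_le i : grid i <= grid i.+1.
Proof.
case: (ltngtP i m.+1) => im.
- rewrite /grid im (ltnW im) ler_wpM2r ?invr_ge0 ?ler0n //.
  by rewrite ler_wpM2l // ler_nat.
- by rewrite /grid !ifF // leqNgt ?im // ltnS ltnW.
- by rewrite im grid_end grid_next ltW.
Qed.

Definition grid_increment k (i : nat) w := (N k (grid i.+1) w - N k (grid i) w)%N.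

Lemma prob_grid (B : 'I_n -> set R) (Q : 'I_n -> 'I_m.+2 -> set nat) :
  (forall k, measurable (B k : set (measurableTypeR R))) ->
  P [set w | forall k, B k (D0 k w) /\ forall i : 'I_m.+2, Q k i (grid_increment k i w)] =
  (\prod_k P [set w | B k (D0 k w)] *
   \prod_k \prod_(i < m.+2) P [set w | Q k i (grid_increment k i w)])%E.
Proof.
move=> mB.
pose A (u : 'I_n + 'I_n) : set T := match u with
  | inl k => [set w | B k (D0 k w)]
  | inr k => [set w | forall i : 'I_m.+2, Q k i (grid_increment k i w)] end.
have := @mutually_independentT _ _ _ P _ _ A indep.
rewrite big_sumType /= => H.
transitivity (P [set w | forall u, A u w]).
  congr (P _); apply/seteqP; split=> w Aw; first by case=> k; case: (Aw k).
  by move=> k; split; [exact: (Aw (inl k))|exact: (Aw (inr k))].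
rewrite H; last first.
  case=> k; first exact: sigma_rv_preimage.
  exact: sigma_process_increments.
congr (_ * _)%E; apply: eq_bigr => k _.
have indk := @poisson_independent_increments _ _ _ _ _ _ (gk_poisson (gk k))
  m.+2 grid (grid_ge0 0) grid_le.
apply: (@mutually_independentT _ _ _ P _ _ (fun i => [set w | Q k i (grid_increment k i w)]) indk).
by move=> i; exact: sigma_rv_preimage.
Qed.

Definition jump_event (Q : 'I_n -> set nat) : set T :=
  [set w | forall k, Q k (N k t w - N k s w)%N].

(** Both sides are the same product of probabilities of elementary events: one
    for each initial direction and each grid step of each process.  The factors
    of the past are collected by comparing with [Q' = setT]. *)
Lemma prob_grid_jump_event (B : 'I_n -> set R) (Q : 'I_n -> 'I_m.+1 -> set nat)
    (Q' : 'I_n -> set nat) :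
  (forall k, measurable (B k : set (measurableTypeR R))) ->
  let past :=
    [set w | forall k, B k (D0 k w) /\ forall i : 'I_m.+1, Q k i (grid_increment k i w)] in
  P (past `&` jump_event Q') =
  (P past * \prod_k P [set w | Q' k (N k t w - N k s w)%N])%E.
Proof.
move=> mB past.
(* The last grid step, [ord_max], is (s, t]; it carries the condition [q]. *)
pose QQ (q : 'I_n -> set nat) k (i : 'I_m.+2) : set nat :=
  if unlift ord_max i is Some j then Q k j else q k.
have grid_increment_last k : grid_increment k m.+1 =1 (fun w => N k t w - N k s w)%N.
  by move=> w; rewrite /grid_increment grid_next grid_end.
have prob_past q : P (past `&` jump_event q) =
    (\prod_k P [set w | B k (D0 k w)] *
     \prod_k \prod_(i < m.+1) P [set w | Q k i (grid_increment k i w)] *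
     \prod_k P [set w | q k (N k t w - N k s w)%N])%E.
  rewrite -muleA -big_split /=.
  transitivity (P [set w | forall k, B k (D0 k w) /\
      forall i : 'I_m.+2, QQ q k i (grid_increment k i w)]).
    congr (P _); apply/seteqP; split=> w /=.
      move=> [pw qw] k; have [Bk Qk] := pw k; split=> // i; rewrite /QQ.
      case: unliftP => [j ->|->]; last by rewrite grid_increment_last; exact: qw.
      by rewrite lift_max; exact: Qk.
    move=> H; split=> [k|k]; have [Bk Qk] := H k.
      split=> // i; have := Qk (lift ord_max i).
      by rewrite /QQ liftK lift_max.
    by have := Qk ord_max; rewrite /QQ unlift_none grid_increment_last.
  rewrite prob_grid //; congr (_ * _)%E; apply: eq_bigr => k _.
  rewrite big_ord_recr /=; congr (_ * _)%E.
    apply: eq_bigr => i _; congr (P _); rewrite /QQ.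
    by rewrite (_ : widen_ord _ i = lift ord_max i) ?liftK //; apply: val_inj;
      rewrite /= /bump leqNgt ltn_ord.
  rewrite /QQ unlift_none; congr (P _); apply/seteqP.
  by split=> w /=; rewrite grid_increment_last.
(* This reads off the probability of the past alone. *)
have -> : P past = P (past `&` jump_event (fun=> setT)).
  by congr (P _); apply/seteqP; split=> [w pw|w []].
rewrite !prob_past; congr (_ * _)%E.
rewrite -[LHS]mule1; congr (_ * _)%E; rewrite big1 // => k _.
by rewrite [X in P X](_ : _ = setT) ?probability_setT //; apply/seteqP; split.
Qed.

Lemma prob_jump_event (Q : 'I_n -> set nat) :
  P (jump_event Q) = (\prod_k P [set w | Q k (N k t w - N k s w)%N])%E.
Proof.
have := @prob_grid_jump_event (fun=> setT) (fun _ _ => setT) Q (fun=> measurableT).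
move=> /=; rewrite (_ : [set _ | _] = setT) ?setTI ?probability_setT ?mul1e //.
by apply/seteqP; split.
Qed.

(** The finite information that determines all directions at the grid times up
    to [s]: initial directions ([true] for -1) and parities of increments. *)
Definition pattern := {ffun 'I_n -> bool * {ffun 'I_m.+1 -> bool}}.

Definition pattern_of (w : T) : pattern :=
  [ffun k => (D0 k w == -1, [ffun i : 'I_m.+1 => odd (grid_increment k i w)])].

Definition pattern_direction (v : pattern) k (i : nat) : R :=
  (-1) ^+ (v k).1 * \prod_(0 <= l < i) (-1) ^+ (v k).2 (inord l).

Lemma pattern_directionP w k i : (i <= m.+1)%N ->
  D k (grid i) w = pattern_direction (pattern_of w) k i.
Proof.
rewrite (gk_direction (gk k)) // /pattern_direction ffunE /=.
have -> : (-1) ^+ (D0 k w == -1) = D0 k w.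
  case: (gk_D0_values (gk k) w) => ->; last by rewrite eqxx expr1.
  rewrite (_ : 1 == -1 :> R = false) // -subr_eq0 opprK.
  by rewrite (pnatr_eq0 R 2).
move=> im; congr (_ * _); elim: i im => [|i IH] im.
  rewrite big_nil (_ : grid 0 = 0) ?(poisson_start (gk_poisson (gk k))) //.
  by rewrite /grid /= mulr0 mul0r.
rewrite big_nat_recr //= -IH 1?ltnW // ffunE inordK // signr_odd -exprD.
by rewrite /grid_increment subnKC // (poisson_nondecreasing (gk_poisson (gk k))).
Qed.

Lemma pattern_of_preimage v : [set w | pattern_of w = v] =
  [set w | forall k, [set (-1) ^+ (v k).1] (D0 k w) /\
     forall i : 'I_m.+1, [set j | odd j = (v k).2 i] (grid_increment k i w)].
Proof.
have neq11 : (1 == -1 :> R) = false.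
  by rewrite -subr_eq0 opprK (pnatr_eq0 R 2).
apply/seteqP; split=> w /= pw.
  move=> k; rewrite -pw ffunE /=; split=> [|i]; last by rewrite ffunE.
  by case: (gk_D0_values (gk k) w) => ->; rewrite ?eqxx ?neq11.
apply/ffunP => k; rewrite ffunE; have [Dk ik] := pw k.
rewrite [v k]surjective_pairing; congr pair; last first.
  by apply/ffunP => i; rewrite ffunE.
by rewrite Dk; case: (v k).1; rewrite ?expr1 ?eqxx ?expr0 ?neq11.
Qed.

Lemma mean_pattern_jump_event (G : pattern -> R) (Q : 'I_n -> set nat) :
  \int[P]_w (G (pattern_of w) * \1_(jump_event Q) w) =
  \int[P]_w G (pattern_of w) * fine (P (jump_event Q)).
Proof.
have t0 := le_trans s0 (ltW st).
apply: mean_indep_finite => [|v|v].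
- by apply: measurable_forall => k; exact: measurable_increment.
- rewrite pattern_of_preimage; apply: measurable_forall => k; apply: measurableI.
    rewrite -[X in measurable X]setTI.
    apply: (gk_D0_measurable (gk k)) => //; exact: measurable_set1.
  by apply: measurable_forall => i; exact: measurable_increment.
- rewrite pattern_of_preimage prob_jump_event.
  apply: (@prob_grid_jump_event (fun k => [set (-1) ^+ (v k).1])
    (fun k i => [set j | odd j = (v k).2 i])) => k.
  exact: measurable_set1.
Qed.

End Grid.

Definition linear_form (t : R) (w : T) : R := \sum_(k < n) a k * X k t w.

Definition state (sigma : signs n) (t : R) : set T :=
  [set w | forall k, D k t w = sgn_at R sigma k].

Lemma measurable_linear_form t : 0 <= t -> measurable_fun setT (linear_form t).
Proof.
move=> t0; apply: measurable_sum => k; apply: measurable_funM => //.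
exact: measurable_position (gk k) _ t0.
Qed.

Lemma measurable_state sigma t : 0 <= t -> measurable (state sigma t).
Proof.
move=> t0; apply: measurable_forall => k; rewrite -[X in measurable X]setTI.
exact: (measurable_direction (gk k) t0 measurableT (measurable_set1 _)).
Qed.

Lemma bounded_rv_state (phi : R -> R) M sigma t : 0 <= t ->
  continuous phi -> (forall x, `|phi x| <= M) ->
  bounded_rv (fun w => phi (linear_form t w) * \1_(state sigma t) w).
Proof.
move=> t0 cphi phiM; apply: bounded_rvM.
  split; last by exists M => w.
  apply: measurableT_comp (measurable_linear_form t0).
  exact: continuous_measurable_fun.
exact/bounded_rv_indic/measurable_state.
Qed.

(** Riemann sums make [phi (L(s))] a limit of functions of the pattern, for
    which the claim is [mean_pattern_jump_event]; the common bound [M] allows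
    dominated convergence on both sides. *)
Lemma mean_state_jump_event (phi : R -> R) M sigma s t (Q : 'I_n -> set nat) :
  continuous phi -> (forall x, `|phi x| <= M) -> 0 <= s -> s < t ->
  \int[P]_w (phi (linear_form s w) * \1_(state sigma s) w * \1_(jump_event s t Q) w) =
  \int[P]_w (phi (linear_form s w) * \1_(state sigma s) w)
    * fine (P (jump_event s t Q)).
Proof.
move=> cphi phiM s0 st; have t0 := le_trans s0 (ltW st).
have mphi : measurable_fun setT phi by exact: continuous_measurable_fun.
have mJ : measurable (jump_event s t Q).
  by apply: measurable_forall => k; exact: measurable_increment.
have mS : measurable (state sigma s) by exact: measurable_state.
have M0 : 0 <= M by exact: le_trans (phiM 0).
have ind1 A w : `|\1_A w : R| <= 1.
  by rewrite indicE ger0_norm ?ler0n // lern1 leq_b1.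
pose L_ m w := \sum_(k < n) a k * riemann_position (c k) (x0 k) (D k) s m w.
have L_L w : L_ ^~ w @ \oo --> linear_form s w.
  apply: cvg_big => [|k _]; [exact: add_continuous|]; apply: cvgM; first exact: cvg_cst.
  exact: riemann_position_cvg (gk k) _ _ s0.
have mL m : measurable_fun setT (L_ m).
  apply: measurable_sum => k; apply: measurable_funM => //.
  exact: (measurable_riemann_position (gk k)).
pose Y m w := phi (L_ m w) * \1_(state sigma s) w.
have mY m : measurable_fun setT (Y m).
  apply: measurable_funM; last exact: measurable_indic.
  exact: measurableT_comp.
have YM m w : `|Y m w| <= M.
  by rewrite normrM -[leRHS]mulr1 ler_pM.
have cY w : Y ^~ w @ \oo --> phi (linear_form s w) * \1_(state sigma s) w.
  apply: cvgM; last exact: cvg_cst.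
  by apply: cvg_comp (L_L w) _; exact: cphi.
have YP m : \int[P]_w (Y m w * \1_(jump_event s t Q) w) =
    \int[P]_w Y m w * fine (P (jump_event s t Q)).
  pose G (v : pattern m) : R := phi (\sum_(k < n) a k * (x0 k +
      c k * (s / m.+1%:R) * \sum_(i < m.+1) pattern_direction v k i)) *
    \1_[set v | forall k, pattern_direction v k m.+1 = sgn_at R sigma k] v.
  have YG w : Y m w = G (pattern_of s t m w).
    rewrite /Y /G /L_; congr (phi _ * _).
      apply: eq_bigr => k _; congr (_ * (_ + _ * _)); apply: eq_bigr => i _.
      by rewrite -pattern_directionP // 1?ltnW ?/grid // ifT // ltnW.
    rewrite !indicE; congr (_%:R); congr nat_of_bool.
    apply/idP/idP => /set_mem H; apply/mem_set => k; have := H k.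
      by rewrite -pattern_directionP // /grid leqnn mulfK // pnatr_eq0.
    by rewrite -pattern_directionP // /grid leqnn mulfK // pnatr_eq0.
  under eq_Rintegral => w _ do rewrite YG.
  by rewrite mean_pattern_jump_event //; congr (_ * _); apply: eq_Rintegral => w _; rewrite YG.
have l1 : \int[P]_w (Y m w * \1_(jump_event s t Q) w) @[m --> \oo] -->
    \int[P]_w (phi (linear_form s w) * \1_(state sigma s) w * \1_(jump_event s t Q) w).
  apply: (@mean_cvg _ _ _ P _ _ M) => [m|m w|w].
  - by apply: measurable_funM => //; exact: measurable_indic.
  - by rewrite normrM -[leRHS]mulr1 ler_pM.
  - by apply: cvgM; [exact: cY|exact: cvg_cst].
have l2 : \int[P]_w (Y m w * \1_(jump_event s t Q) w) @[m --> \oo] -->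
    \int[P]_w (phi (linear_form s w) * \1_(state sigma s) w) *
    fine (P (jump_event s t Q)).
  under eq_fun do rewrite YP.
  by apply: cvgM; [exact: (@mean_cvg _ _ _ P Y _ M mY YM cY)|exact: cvg_cst].
exact: (cvg_unique _ l1 l2).
Qed.

End Independence.

(** * Taylor estimates and derivatives from quadratic estimates *)

Section Taylor.
Context (R : realType).
Implicit Types (f df ddf : R -> R) (M x y : R).

Lemma is_derive_continuous f df :
  (forall x, is_derive x 1 f (df x)) -> continuous f.
Proof.
move=> fdf x; apply: differentiable_continuous.
by apply/derivable1_diffP; have [] := fdf x.
Qed.

Lemma mean_value f df x y : (forall x, is_derive x 1 f (df x)) ->
  exists2 z, `|z - x| <= `|y - x| & f y - f x = df z * (y - x).
Proof.
move=> fdf; have cf := is_derive_continuous fdf.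
have [xy|/ltW yx] := leP x y.
  have [z] := MVT_segment xy (fun x _ => fdf x) (continuous_subspaceT cf).
  rewrite in_itv /= => /andP[xz zy] E; exists z => //.
  by rewrite !ger0_norm ?subr_ge0 // lerD2r.
have [z] := MVT_segment yx (fun x _ => fdf x) (continuous_subspaceT cf).
rewrite in_itv /= => /andP[yz zx] E; exists z.
  by rewrite !ler0_norm ?subr_le0 // !opprB lerD2l lerN2.
by rewrite -[LHS]opprB E -mulrN opprB.
Qed.

Lemma derive_bound_lipschitz f df M x y : (forall x, is_derive x 1 f (df x)) ->
  (forall x, `|df x| <= M) -> `|f y - f x| <= M * `|y - x|.
Proof.
move=> fdf dfM; have [z _ ->] := mean_value x y fdf.
by rewrite normrM ler_wpM2r.
Qed.

Lemma taylor1_bound f df ddf M x y : (forall x, is_derive x 1 f (df x)) ->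
  (forall x, is_derive x 1 df (ddf x)) -> (forall x, `|ddf x| <= M) ->
  `|f y - f x - df x * (y - x)| <= M * (y - x) ^+ 2.
Proof.
move=> fdf dfddf ddfM; have [z zx ->] := mean_value x y fdf.
rewrite -mulrBl normrM -(real_normK (num_real (y - x))) expr2 mulrA ler_wpM2r //.
apply: le_trans (derive_bound_lipschitz _ _ dfddf ddfM) _.
by rewrite ler_wpM2l //; exact: le_trans (ddfM 0).
Qed.

(** For a negative increment the hypothesis is available only with the base
    point [t + h] in place of [t]; the Lipschitz bound on [G] moves it back to
    [t] at the cost of another term of order [h ^+ 2]. *)
Lemma is_derive_quadratic (f G : R -> R) (C K t : R) :
  (forall s t, 0 <= s -> s < t -> `|f t - f s - (t - s) * G s| <= C * (t - s) ^+ 2) ->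
  (forall s t, 0 <= s -> s < t -> t - s <= 1 -> `|G t - G s| <= K * (t - s)) ->
  0 < t -> is_derive t 1 f (G t).
Proof.
move=> fG GK t0.
have C0 : 0 <= C.
  have := fG 0 1 (lexx _) ltr01; rewrite subr0 expr1n mulr1.
  exact: le_trans.
have K0 : 0 <= K.
  have := GK 0 1 (lexx _) ltr01; rewrite subr0 lexx mulr1 => /(_ isT).
  exact: le_trans.
suff cvgf : (h^-1 *: ((f \o shift t) (h *: 1) - f t)) @[h --> 0^'] --> G t.
  apply: DeriveDef; first by apply/cvg_ex; exists (G t).
  exact: cvg_lim cvgf.
have quad h : h != 0 -> `|h| <= 1 -> `|h| <= t ->
    `|f (h + t) - f t - h * G t| <= (C + K) * h ^+ 2.
  move=> h0 h1 ht; rewrite -(real_normK (num_real h)) mulrDl.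
  have [hp|hn] := ltP 0 h.
    have := fG t (h + t) (ltW t0); rewrite addrK ltrDr hp gtr0_norm // => /(_ isT).
    by move/le_trans; apply; rewrite lerDl mulr_ge0 // sqr_ge0.
  have {hn}hn : h < 0 by rewrite lt_neqAle h0.
  move: h1 ht; rewrite ltr0_norm // => h1 ht.
  have s0 : 0 <= h + t by rewrite addrC -[h]opprK subr_ge0.
  have st : h + t < t by rewrite gtrDr.
  have dst : t - (h + t) = - h by rewrite opprD addrCA subrr addr0.
  have := fG _ _ s0 st; have := GK _ _ s0 st; rewrite dst => /(_ h1) GKst fGst.
  have -> : f (h + t) - f t - h * G t =
      - (f t - f (h + t) - - h * G (h + t)) + (- h) * (G t - G (h + t)) by ring.
  apply: le_trans (ler_normD _ _) _; rewrite normrN lerD //.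
  rewrite normrM gtr0_norm ?oppr_gt0 // expr2 mulrCA ler_wpM2l //.
  by rewrite oppr_ge0 ltW.
have CK0 : 0 < C + K + 1 by rewrite ltr_wpDl ?addr_ge0 ?ltr01.
apply/cvgrPdist_le => e e0; near=> h.
have h0 : h != 0 by near: h; exact: nbhs_dnbhs_neq.
have hn0 : 0 < `|h| by rewrite normr_gt0.
rewrite distrC /= scaler1.
have -> : h^-1 *: (f (h + t) - f t) - G t = h^-1 * (f (h + t) - f t - h * G t).
  by rewrite mulrBr mulKf.
rewrite normrM normfV mulrC ler_pdivrMr //.
apply: le_trans (quad h h0 _ _) _.
- near: h; exact: dnbhs0_le.
- near: h; exact: dnbhs0_le.
rewrite -(real_normK (num_real h)) expr2 mulrA ler_pM2r //.
apply: (@le_trans _ _ ((C + K + 1) * `|h|)).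
  by rewrite ler_wpM2r // lerDl.
rewrite mulrC -ler_pdivlMr //; near: h; apply: dnbhs0_le; exact: divr_gt0.
Unshelve. all: end_near. Qed.

End Taylor.

(** * One-step expansion of the expectations *)

(** All three follow from [1 - x <= expR (- x)] and
    [(1 + x) * expR (- x) <= 1]. The middle quantity of the last one is the
    probability that a Poisson variable of mean [x] is at least 2. *)
Lemma expRN_bounds (R : realType) (x : R) : 0 <= x ->
  [/\ 0 <= 1 - expR (- x) <= x, 0 <= expR (- x) - 1 + x <= x ^+ 2 &
      0 <= 1 - expR (- x) - x * expR (- x) <= x ^+ 2].
Proof.
move=> x0; have e1 := expR_ge1Dx (- x); have e2 := expR_ge1Dx x.
have e0 := expR_gt0 (- x); have e3 : expR x * expR (- x) = 1 by rewrite -expRD subrr expR0.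
have e4 : (1 + x) * expR (- x) <= 1 by rewrite -[leRHS]e3 ler_pM2r.
have e5 : expR (- x) <= 1 - x + x ^+ 2.
  suff : (1 + x) * expR (- x) <= (1 + x) * (1 - x + x ^+ 2).
    by rewrite ler_pM2l // ltr_wpDr.
  apply: le_trans e4 _; have := exprn_ge0 3 x0; lra.
have e6 : (1 + x) * (1 - x) <= (1 + x) * expR (- x) by rewrite ler_wpM2l // addr_ge0.
have e7 : 0 <= x * expR (- x) by rewrite mulr_ge0 // ltW.
by split; apply/andP; split; lra.
Qed.

Section Generator.
Context (d : measure_display) (T : measurableType d) (R : realType).
Variable P : probability T R.
Variables (n : nat) (c lam x0 a : 'I_n -> R).
Variables (D0 : 'I_n -> T -> R) (N : 'I_n -> R -> T -> nat).
Variables (D X : 'I_n -> R -> T -> R).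
Hypothesis gk :
  forall k, goldstein_kac P (c k) (lam k) (x0 k) (D0 k) (N k) (D k) (X k).
Hypothesis indep : independent_telegraphs P D0 N.

Local Notation L := (linear_form a X).
Local Notation state := (state D).
Local Notation jump_event := (jump_event N).
Local Notation Lam := (lam_total lam).

Definition no_jump (s t : R) : set T := jump_event s t (fun=> [set 0%N]).
Definition one_jump k (s t : R) : set T :=
  jump_event s t (fun l => [set nat_of_bool (l == k)]).

Lemma lam_total_ge0 : 0 <= Lam.
Proof. by apply: sumr_ge0 => k _; exact: ltW (gk_rate_gt0 (gk k)). Qed.

Lemma prob_jump_event_pmf s t (j : 'I_n -> nat) : 0 <= s -> s < t ->
  P (jump_event s t (fun k => [set j k])) =
  (\prod_k ((lam k * (t - s)) ^+ j k / (j k)`!%:R)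
    * expR (- (Lam * (t - s))))%:E.
Proof.
move=> s0 st; rewrite (prob_jump_event gk indep 0) //.
have -> : expR (- (Lam * (t - s))) = \prod_k expR (- (lam k * (t - s))).
  by rewrite -expR_sum sumrN -mulr_suml.
rewrite -big_split /= -prodEFin; apply: eq_bigr => k _.
rewrite (poisson_increment_law (gk_poisson (gk k))) // /poisson_pmf ifT //.
by rewrite mulr_gt0 ?subr_gt0 // (gk_rate_gt0 (gk k)).
Qed.

Lemma prob_no_jump s t : 0 <= s -> s < t ->
  P (no_jump s t) = (expR (- (Lam * (t - s))))%:E.
Proof.
move=> s0 st; rewrite prob_jump_event_pmf // big1 ?mul1r // => k _.
by rewrite expr0 fact0 divr1.
Qed.

Lemma prob_one_jump k s t : 0 <= s -> s < t ->
  P (one_jump k s t) = (lam k * (t - s) * expR (- (Lam * (t - s))))%:E.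
Proof.
move=> s0 st; rewrite prob_jump_event_pmf // (bigD1 k) //= eqxx expr1 factS fact0 mul1n divr1.
rewrite big1 ?mulr1 // => l /negbTE ->.
by rewrite expr0 fact0 divr1.
Qed.

Lemma no_jump_direction s t w k : 0 <= s -> s < t -> no_jump s t w ->
  N k t w = N k s w /\ D k t w = D k s w.
Proof.
move=> s0 st /(_ k) /= /eqP; rewrite subn_eq0 => Nts.
have Nst : N k t w = N k s w.
  apply/eqP; rewrite eqn_leq Nts.
  exact: (poisson_nondecreasing (gk_poisson (gk k)) _ s0 (ltW st)).
by rewrite !(gk_direction (gk k)) ?Nst // (le_trans s0 (ltW st)).
Qed.

Lemma one_jump_direction k s t w l : 0 <= s -> s < t -> one_jump k s t w ->
  D l t w = (if l == k then - D l s w else D l s w).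
Proof.
move=> s0 st /(_ l) /= Nts.
have Nst := poisson_nondecreasing (gk_poisson (gk l)) w s0 (ltW st).
rewrite !(gk_direction (gk l)) ?(le_trans s0 (ltW st)) // -(subnK Nst) Nts.
by case: eqP => _; rewrite ?add0n // add1n exprS mulN1r mulrN.
Qed.

Lemma sgn_at_flip (sigma : signs n) k l :
  sgn_at R (flip sigma k) l =
  if l == k then - sgn_at R sigma l else sgn_at R sigma l.
Proof. by rewrite /sgn_at ffunE; case: eqP => // _; rewrite signrN. Qed.

Lemma no_jump_state sigma s t w : 0 <= s -> s < t -> no_jump s t w ->
  (w \in state sigma t) = (w \in state sigma s).
Proof.
move=> s0 st nw; apply/idP/idP => /set_mem H; apply/mem_set => k;
by have := H k; rewrite (no_jump_direction k s0 st nw).2.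
Qed.

Lemma one_jump_state sigma k s t w : 0 <= s -> s < t -> one_jump k s t w ->
  (w \in state sigma t) = (w \in state (flip sigma k) s).
Proof.
move=> s0 st ow; apply/idP/idP => /set_mem H; apply/mem_set => l; have := H l;
  rewrite (one_jump_direction l s0 st ow) sgn_at_flip; case: eqP => // _.
  by move=> <-; rewrite opprK.
by move=> ->; rewrite opprK.
Qed.

(** Without switches the motion is ballistic, with a velocity that the state
    determines; this is where [c_sigma] comes from. *)
Lemma no_jump_linear_form sigma s t w : 0 <= s -> s < t -> no_jump s t w ->
  state sigma s w -> L t w - L s w = c_sigma a c sigma * (t - s).
Proof.
move=> s0 st nw sw; rewrite /linear_form -sumrB /c_sigma mulr_suml.
apply: eq_bigr => k _; rewrite -mulrBr.
rewrite (position_no_switch (gk k) s0 (ltW st) (no_jump_direction k s0 st nw).1).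
by rewrite (sw k); ring.
Qed.

Definition max_speed : R := \sum_(k < n) `|a k| * c k.

Lemma max_speed_ge0 : 0 <= max_speed.
Proof.
by apply: sumr_ge0 => k _; rewrite mulr_ge0 // ltW // (gk_speed_gt0 (gk k)).
Qed.

Lemma linear_form_lipschitz s t w : 0 <= s -> s < t ->
  `|L t w - L s w| <= max_speed * (t - s).
Proof.
move=> s0 st; rewrite /linear_form -sumrB /max_speed mulr_suml.
apply: le_trans (ler_norm_sum _ _ _) _; apply: ler_sum => k _.
rewrite -mulrBr normrM -mulrA ler_wpM2l //.
exact: (position_lipschitz (gk k) w s0 (ltW st)).
Qed.

Lemma measurable_jump_event s t Q : 0 <= s -> s < t -> measurable (jump_event s t Q).
Proof.
move=> s0 st; have t0 := le_trans s0 (ltW st).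
by apply: measurable_forall => k; apply: (measurable_increment gk).
Qed.

Lemma no_jump_notin_one_jump k s t w : no_jump s t w -> w \in one_jump k s t = false.
Proof.
by move=> nw; apply/negP => /set_mem /(_ k) /=; rewrite (nw k) eqxx.
Qed.

Lemma one_jump_inj k l s t w : one_jump k s t w ->
  (w \in one_jump l s t) = (l == k).
Proof.
move=> kw; apply/idP/eqP => [/set_mem lw|->]; last exact/mem_set.
by have := kw l; have := lw l; rewrite /= => -> ; rewrite eqxx; case: eqP.
Qed.

(** The density [f_sigma (., t)] tested against [phi], written as an
    expectation. *)
Definition pairing (sigma : signs n) (t : R) (phi : R -> R) : R :=
  \int[P]_w (phi (L t w) * \1_(state sigma t) w).

Section Estimate.
Variables (phi dphi ddphi : R -> R) (M : R).
Hypothesis dphiP : forall x : R, is_derive x 1 phi (dphi x).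
Hypothesis ddphiP : forall x : R, is_derive x 1 dphi (ddphi x).
Hypothesis phiM : forall x, `|phi x| <= M.
Hypothesis dphiM : forall x, `|dphi x| <= M.
Hypothesis ddphiM : forall x, `|ddphi x| <= M.

Let M0 : 0 <= M := le_trans (normr_ge0 _) (phiM 0).

Let ind01 (A : set T) w : 0 <= (\1_A w : R) <= 1.
Proof. by rewrite indicE ler0n lern1 leq_b1. Qed.

Let ind1 (A : set T) w : `|\1_A w : R| <= 1.
Proof. by have /andP[i0 i1] := ind01 A w; rewrite ger0_norm. Qed.

(** The first-order contributions: free motion along the state [sigma], and a
    single switch of the [k]-th process, which enters [sigma] from the flipped
    state.  The displacement during the step is dropped in the latter, since the
    probability of a switch is already of first order. *)
Definition main_part sigma (s t : R) (w : T) : R :=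
  (phi (L s w) * \1_(state sigma s) w * \1_(no_jump s t) w
   + c_sigma a c sigma * (t - s) *
     (dphi (L s w) * \1_(state sigma s) w * \1_(no_jump s t) w))
  + \sum_(k < n) phi (L s w) * \1_(state (flip sigma k) s) w * \1_(one_jump k s t) w.

(** One term for each alternative: the Taylor remainder, the displacement
    neglected at a single switch, and the trivial bound on the event of two or
    more switches. *)
Definition error_bound sigma (s t : R) (w : T) : R :=
  M * (c_sigma a c sigma * (t - s)) ^+ 2
  + M * (max_speed * (t - s)) * (\sum_(k < n) \1_(one_jump k s t) w)
  + M * (1 - (\1_(no_jump s t) w + \sum_(k < n) \1_(one_jump k s t) w)).

(** The three alternatives exclude each other, and on each of them only one term
    of the bound is used. *)
Lemma pointwise_error sigma s t w : 0 <= s -> s < t ->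
  `|phi (L t w) * \1_(state sigma t) w - main_part sigma s t w|
    <= error_bound sigma s t w.
Proof.
move=> s0 st; have ts0 : 0 <= t - s by rewrite subr_ge0 ltW.
have K0 := max_speed_ge0.
have A0 : 0 <= M * (c_sigma a c sigma * (t - s)) ^+ 2 by rewrite mulr_ge0 ?sqr_ge0.
rewrite /main_part /error_bound.
have [nw|nw] := pselect (no_jump s t w).
  have one0 k : \1_(one_jump k s t) w = 0 :> R.
    by rewrite indicE no_jump_notin_one_jump.
  rewrite [\sum_(k < n) \1__ _]big1 => [|k _]; last exact: one0.
  rewrite [\sum_(k < n) _]big1 => [|k _]; last by rewrite one0 mulr0.
  rewrite [\1_(no_jump s t) w]indicE mem_set // !mulr1 !addr0 subrr !mulr0 !addr0.
  rewrite !indicE (no_jump_state sigma s0 st nw).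
  have [/set_mem sw|sw] := boolP (w \in state sigma s).
    rewrite !mulr1 opprD addrA -(no_jump_linear_form s0 st nw sw).
    by rewrite [_ * dphi _]mulrC; exact: taylor1_bound dphiP ddphiP ddphiM.
  by rewrite !mulr0 addr0 subrr normr0.
rewrite [\1_(no_jump s t) w]indicE memNset // !mulr0 !add0r.
have [[k kw]|nk] := pselect (exists k, one_jump k s t w).
  have oneE l : \1_(one_jump l s t) w = (l == k)%:R :> R.
    by rewrite indicE (one_jump_inj l kw).
  have -> : \sum_(l < n) (\1_(one_jump l s t) w : R) = 1.
    rewrite (bigD1 k) //= oneE eqxx big1 ?addr0 // => l /negbTE lk.
    by rewrite oneE lk.
  rewrite (bigD1 k) //= oneE eqxx mulr1 big1 => [|l /negbTE lk]; last first.
    by rewrite oneE lk mulr0.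
  rewrite addr0 subrr mulr0 addr0 mulr1 !indicE (one_jump_state sigma s0 st kw).
  rewrite -mulrBl normrM; apply: (@le_trans _ _ (M * (max_speed * (t - s)))).
    rewrite -[leRHS]mulr1 ler_pM ?ler0n //; last by rewrite ger0_norm ?lern1 ?leq_b1.
    apply: le_trans (derive_bound_lipschitz _ _ dphiP dphiM) _.
    by rewrite ler_wpM2l // linear_form_lipschitz.
  by rewrite lerDr.
have one0 k : \1_(one_jump k s t) w = 0 :> R.
  by rewrite indicE memNset // => kw; apply: nk; exists k.
rewrite [\sum_(k < n) \1__ _]big1 => [|k _]; last exact: one0.
rewrite [\sum_(k < n) _]big1 => [|k _]; last by rewrite one0 mulr0.
rewrite !subr0 mulr0 addr0 mulr1 normrM.
apply: (@le_trans _ _ M); last by rewrite lerDr.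
by rewrite -[leRHS]mulr1 ler_pM.
Qed.

Let cphi : continuous phi := is_derive_continuous dphiP.
Let cdphi : continuous dphi := is_derive_continuous ddphiP.

Lemma norm_pairing sigma s : 0 <= s -> `|pairing sigma s phi| <= M.
Proof.
move=> s0; apply: norm_mean_le.
  exact: (bounded_rv_state a gk _ s0 cphi phiM).
by move=> w; rewrite normrM -[leRHS]mulr1 ler_pM.
Qed.

Lemma mean_main_part sigma s t : 0 <= s -> s < t ->
  \int[P]_w main_part sigma s t w =
  expR (- (Lam * (t - s))) * (pairing sigma s phi
    + c_sigma a c sigma * (t - s) * pairing sigma s dphi
    + (t - s) * \sum_(k < n) lam k * pairing (flip sigma k) s phi).
Proof.
move=> s0 st.
have bJ Q : bounded_rv (\1_(jump_event s t Q) : T -> R).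
  exact/bounded_rv_indic/measurable_jump_event.
have bphi sig Q : bounded_rv
    (fun w => phi (L s w) * \1_(state sig s) w * \1_(jump_event s t Q) w).
  by apply: bounded_rvM => //; exact: (bounded_rv_state a gk _ s0 cphi phiM).
have bdphi sig Q : bounded_rv
    (fun w => dphi (L s w) * \1_(state sig s) w * \1_(jump_event s t Q) w).
  by apply: bounded_rvM => //; exact: (bounded_rv_state a gk _ s0 cdphi dphiM).
rewrite meanD; last 2 first.
- by apply: bounded_rvD; [exact: bphi|apply: bounded_rvZ; exact: bdphi].
- by apply: bounded_rv_sum => k; exact: bphi.
rewrite meanD; last 2 first.
- exact: bphi.
- by apply: bounded_rvZ; exact: bdphi.
rewrite meanZ; last exact: bdphi.
rewrite mean_sum => [|k]; last exact: bphi.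
rewrite (mean_state_jump_event a gk indep _ _ cphi phiM s0 st).
rewrite (mean_state_jump_event a gk indep _ _ cdphi dphiM s0 st).
rewrite prob_no_jump //= -!/(pairing _ _ _).
rewrite [X in _ + X](_ : _ = expR (- (Lam * (t - s))) * ((t - s) *
    \sum_(k < n) lam k * pairing (flip sigma k) s phi)).
  by ring.
rewrite !mulr_sumr; apply: eq_bigr => k _.
rewrite (mean_state_jump_event a gk indep _ _ cphi phiM s0 st).
by rewrite prob_one_jump //= -!/(pairing _ _ _); ring.
Qed.

Lemma mean_error_bound sigma s t : 0 <= s -> s < t ->
  \int[P]_w error_bound sigma s t w <=
  M * (c_sigma a c sigma ^+ 2 + max_speed * Lam + Lam ^+ 2) * (t - s) ^+ 2.
Proof.
move=> s0 st; have ts0 : 0 <= t - s by rewrite subr_ge0 ltW.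
have bno : bounded_rv (\1_(no_jump s t) : T -> R).
  exact/bounded_rv_indic/measurable_jump_event.
have bone k : bounded_rv (\1_(one_jump k s t) : T -> R).
  exact/bounded_rv_indic/measurable_jump_event.
have bsum : bounded_rv (fun w => \sum_(k < n) \1_(one_jump k s t) w : R).
  exact: bounded_rv_sum.
rewrite meanD; last 2 first.
- by apply: bounded_rvD; [exact: bounded_rv_cst|exact: bounded_rvZ].
- apply: bounded_rvZ; apply: bounded_rvB; first exact: bounded_rv_cst.
  exact: bounded_rvD.
rewrite meanD; [|exact: bounded_rv_cst|exact: bounded_rvZ].
rewrite mean_cst meanZ // meanZ; last first.
  by apply: bounded_rvB; [exact: bounded_rv_cst|exact: bounded_rvD].
rewrite meanB; [|exact: bounded_rv_cst|exact: bounded_rvD].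
rewrite mean_cst meanD // mean_sum //.
rewrite mean_indic; last exact: measurable_jump_event.
under eq_bigr => k _.
  rewrite mean_indic; last exact: measurable_jump_event.
  rewrite prob_one_jump //=; over.
rewrite prob_no_jump //= -!mulr_suml -/Lam.
set x := Lam * (t - s); have x0' : 0 <= x by rewrite mulr_ge0 ?lam_total_ge0.
have [_ _ /andP[_ e2]] := expRN_bounds x0'.
have e1 : expR (- x) <= 1 by rewrite expR_le1 oppr_le0.
have K0 := max_speed_ge0.
apply: (@le_trans _ _ (M * (c_sigma a c sigma * (t - s)) ^+ 2
  + M * (max_speed * (t - s)) * x + M * x ^+ 2)); last first.
  by rewrite le_eqVlt; apply/orP; left; apply/eqP; rewrite /x; ring.
apply: lerD; first rewrite lerD2l.
  rewrite ler_wpM2l ?mulr_ge0 // -[leRHS]mulr1 ler_wpM2l //.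
by rewrite ler_wpM2l // opprD addrA.
Qed.

(** The right-hand side of the system, tested against [phi]; [dphi] carries the
    derivative in x. *)
Definition generator sigma s : R :=
  c_sigma a c sigma * pairing sigma s dphi - Lam * pairing sigma s phi
  + \sum_(k < n) lam k * pairing (flip sigma k) s phi.

(** The constant does not depend on [s] and [t]; both the Lipschitz bound on
    the generator and the two-sided derivative rely on this. *)
Lemma generator_estimate sigma : exists C, forall s t, 0 <= s -> s < t ->
  `|pairing sigma t phi - pairing sigma s phi - (t - s) * generator sigma s|
    <= C * (t - s) ^+ 2.
Proof.
pose cs := c_sigma a c sigma.
(* The first summand comes from the pointwise error, the second from expanding
   the exponential factor of the main part. *)
exists (M * (cs ^+ 2 + max_speed * Lam + Lam ^+ 2) +
  M * (Lam ^+ 2 + `|cs| * Lam + Lam ^+ 2)) => s t s0 st.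
have ts0 : 0 <= t - s by rewrite subr_ge0 ltW.
have t0 := le_trans s0 (ltW st).
have bmain : bounded_rv (main_part sigma s t).
  apply: bounded_rvD; first apply: bounded_rvD; last first.
  - apply: bounded_rv_sum => k; apply: bounded_rvM.
      exact: (bounded_rv_state a gk _ s0 cphi phiM).
    exact/bounded_rv_indic/measurable_jump_event.
  - apply: bounded_rvZ; apply: bounded_rvM.
      exact: (bounded_rv_state a gk _ s0 cdphi dphiM).
    exact/bounded_rv_indic/measurable_jump_event.
  - apply: bounded_rvM; first exact: (bounded_rv_state a gk _ s0 cphi phiM).
    exact/bounded_rv_indic/measurable_jump_event.
have bZ := bounded_rv_state a gk sigma t0 cphi phiM.
have berr : bounded_rv (error_bound sigma s t).
  have bsum : bounded_rv (fun w => \sum_(k < n) \1_(one_jump k s t) w : R).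
    by apply: bounded_rv_sum => k; exact/bounded_rv_indic/measurable_jump_event.
  apply: bounded_rvD; first apply: bounded_rvD.
  - exact: bounded_rv_cst.
  - exact: bounded_rvZ.
  - apply: bounded_rvZ; apply: bounded_rvB; first exact: bounded_rv_cst.
    apply: bounded_rvD => //; exact/bounded_rv_indic/measurable_jump_event.
have E1 : `|pairing sigma t phi - \int[P]_w main_part sigma s t w| <=
    M * (cs ^+ 2 + max_speed * Lam + Lam ^+ 2) * (t - s) ^+ 2.
  rewrite /pairing -meanB //; apply: le_trans (mean_error_bound sigma s0 st).
  apply: le_norm_mean => //; first exact: bounded_rvB.
  by move=> w; exact: pointwise_error.
set S := \sum_(k < n) lam k * pairing (flip sigma k) s phi.
have SM : `|S| <= Lam * M.
  rewrite /S /lam_total mulr_suml; apply: le_trans (ler_norm_sum _ _ _) _.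
  apply: ler_sum => k _; have lk := gk_rate_gt0 (gk k).
  by rewrite normrM gtr0_norm // ler_pM2l // norm_pairing.
have gM := norm_pairing sigma s0.
have dgM : `|pairing sigma s dphi| <= M.
  apply: norm_mean_le; first exact: (bounded_rv_state a gk _ s0 cdphi dphiM).
  by move=> w; rewrite normrM -[leRHS]mulr1 ler_pM.
set x := Lam * (t - s); have x0' : 0 <= x by rewrite mulr_ge0 ?lam_total_ge0.
have [/andP[u0 u1] /andP[v0 v1] _] := expRN_bounds x0'.
have E2 : `|\int[P]_w main_part sigma s t w - pairing sigma s phi
    - (t - s) * generator sigma s| <=
    M * (Lam ^+ 2 + `|cs| * Lam + Lam ^+ 2) * (t - s) ^+ 2.
  rewrite mean_main_part // /generator -/S -/cs -/x.
  (* Each coefficient is now a remainder of the exponential, or such a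
     remainder times the step. *)
  rewrite (_ : _ - _ = (expR (- x) - 1 + x) * pairing sigma s phi
     + - (cs * (t - s) * ((1 - expR (- x)) * pairing sigma s dphi))
     + - ((t - s) * ((1 - expR (- x)) * S))); last by rewrite /x; ring.
  apply: le_trans (ler_normD _ _) _.
  have -> : M * (Lam ^+ 2 + `|cs| * Lam + Lam ^+ 2) * (t - s) ^+ 2 =
      x ^+ 2 * M + `|cs| * (t - s) * (x * M) + (t - s) * (x * (Lam * M)).
    by rewrite /x; ring.
  rewrite normrN; apply: lerD; last first.
    rewrite normrM (ger0_norm ts0) ler_wpM2l // normrM (ger0_norm u0).
    exact: ler_pM.
  apply: le_trans (ler_normD _ _) _; rewrite normrN; apply: lerD.
    by rewrite normrM (ger0_norm v0) ler_pM.
  rewrite !normrM (ger0_norm ts0) (ger0_norm u0) ler_wpM2l ?mulr_ge0 //.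
  exact: ler_pM.
rewrite [leRHS]mulrDl; apply: le_trans _ (lerD E1 E2).
apply: le_trans _ (ler_normD _ _); rewrite le_eqVlt; apply/orP; left; apply/eqP.
by congr (`|_|); ring.
Qed.

End Estimate.

End Generator.

(** * The system of equations *)

Section UnitLipschitz.
Context (R : realType).
Implicit Types (f g : R -> R).

(** The restriction to steps of length at most 1 lets the quadratic remainder
    of [generator_estimate] be absorbed into a linear bound. *)
Definition unit_lipschitz f := exists K, forall s t,
  0 <= s -> s < t -> t - s <= 1 -> `|f t - f s| <= K * (t - s).

Lemma unit_lipschitzD f g : unit_lipschitz f -> unit_lipschitz g ->
  unit_lipschitz (fun s => f s + g s).
Proof.
move=> [K fK] [K' gK']; exists (K + K') => s t s0 st ts1.
rewrite opprD addrACA mulrDl; apply: le_trans (ler_normD _ _) _.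
by apply: lerD; [exact: fK|exact: gK'].
Qed.

Lemma unit_lipschitzZ r f : unit_lipschitz f -> unit_lipschitz (fun s => r * f s).
Proof.
move=> [K fK]; exists (`|r| * K) => s t s0 st ts1.
by rewrite -mulrBr normrM -mulrA ler_wpM2l // fK.
Qed.

Lemma unit_lipschitz_sum (I : Type) (r : seq I) (F : I -> R -> R) :
  (forall i, unit_lipschitz (F i)) ->
  unit_lipschitz (fun s => \sum_(i <- r) F i s).
Proof.
move=> FK; elim: r => [|i r IH].
  by exists 0 => s t _ _ _; rewrite !big_nil subrr normr0 mul0r.
have [K HK] := unit_lipschitzD (FK i) IH.
by exists K => s t s0 st ts1; rewrite !big_cons; exact: HK.
Qed.

End UnitLipschitz.

Section SchwartzFunctions.
Context (R : realType) (phi : R -> R).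
Hypothesis Sphi : schwartz phi.

Lemma schwartz_is_derive k (x : R) :
  is_derive x 1 (derive1n k phi) (derive1n k.+1 phi x).
Proof.
by apply: DeriveDef; [exact: Sphi.1|rewrite derive1nS derive1E].
Qed.

Lemma schwartz_bounded k : exists M, forall x, `|derive1n k phi x| <= M.
Proof.
by have [M HM] := Sphi.2 0 k; exists M => x; have := HM x; rewrite expr0 mul1r.
Qed.

Lemma schwartz_bounded_upto k : exists M, forall i, (i <= k)%N ->
  forall x, `|derive1n i phi x| <= M.
Proof.
elim: k => [|k [M HM]].
  have [M HM] := schwartz_bounded 0; exists M => i.
  by rewrite leqn0 => /eqP ->.
have [M' HM'] := schwartz_bounded k.+1; exists (Order.max M M') => i.
rewrite leq_eqVlt => /predU1P[-> x|ik x]; rewrite le_max.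
  by rewrite HM' orbT.
by rewrite HM.
Qed.

End SchwartzFunctions.

Section System.
Context (d : measure_display) (T : measurableType d) (R : realType).
Variable P : probability T R.
Variables (n : nat) (c lam x0 a : 'I_n -> R).
Variables (D0 : 'I_n -> T -> R) (N : 'I_n -> R -> T -> nat).
Variables (D X : 'I_n -> R -> T -> R).
Hypothesis gk :
  forall k, goldstein_kac P (c k) (lam k) (x0 k) (D0 k) (N k) (D k) (X k).
Hypothesis indep : independent_telegraphs P D0 N.

Local Notation Lam := (lam_total lam).
Local Notation pairing := (pairing P a D X).

(** The joint law is the image by [L(t)] of [P] restricted to the event that
    the directions are [sigma]. *)
Lemma joint_density_pairing sigma t (phi : R -> R) M : 0 <= t ->
  continuous phi -> (forall x, `|phi x| <= M) ->
  joint_density P a X D sigma t phi = pairing sigma t phi.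
Proof.
move=> t0 cphi phiM; rewrite /joint_density /genfun_of_measure.
have mS := measurable_state gk sigma t0.
have mL := measurable_linear_form a gk t0.
have mphi : measurable_fun setT phi by exact: continuous_measurable_fun.
have bphi : bounded_rv (fun w => phi (linear_form a X t w)).
  by split; [exact: measurableT_comp|exists M => w].
have -> : joint_law P a X D sigma t =
    pushforward (mrestr P mS) (linear_form a X t : T -> measurableTypeR R).
  by [].
rewrite integral_pushforward //; last first.
- rewrite preimage_setT; case: bphi => mf [K fK].
  apply: (@measurable_bounded_integrable _ _ _ _ (phi \o linear_form a X t)) => //.
    rewrite /= /mrestr setTI; exact: le_lt_trans (probability_le1 _ mS) (ltry 1).
  by exists K; split; [exact: num_real|move=> y Ky w _ /=; exact: le_trans (fK w) (ltW Ky)].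
- exact/measurable_EFinP.
by rewrite preimage_setT integral_mrestr.
Qed.

Section TestFunction.
Variable phi : R -> R.
Hypothesis Sphi : schwartz phi.

(** Stated for every derivative of [phi] because the generator involves both
    [phi] and its first derivative. *)
Lemma pairing_unit_lipschitz sigma i :
  unit_lipschitz (fun s => pairing sigma s (derive1n i phi)).
Proof.
have [M HM] := schwartz_bounded_upto Sphi i.+2.
have D1 := schwartz_is_derive Sphi i; have D2 := schwartz_is_derive Sphi i.+1.
have B0 := HM i (leqW (leqnSn i)); have B1 := HM i.+1 (leqnSn _).
have B2 := HM i.+2 (leqnn _).
have [C HC] := generator_estimate a gk indep D1 D2 B0 B1 B2 sigma.
have C0 : 0 <= C.
  have := HC 0 1 (lexx _) ltr01; rewrite subr0 expr1n mulr1; exact: le_trans.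
pose B := `|c_sigma a c sigma| * M + Lam * M + \sum_(k < n) lam k * M.
(* [B] bounds the generator, which governs the increment to first order. *)
exists (C + B) => s t s0 st ts1; have ts0 : 0 <= t - s by rewrite subr_ge0 ltW.
have L0 := lam_total_ge0 gk.
have p0 sig : `|pairing sig s (derive1n i phi)| <= M.
  exact: (norm_pairing a gk D1 B0).
have p1 : `|pairing sigma s (derive1n i.+1 phi)| <= M.
  exact: (norm_pairing a gk D2 B1).
have GB : `|generator P c lam a D X (derive1n i phi) (derive1n i.+1 phi) sigma s| <= B.
  apply: le_trans (ler_normD _ _) _; apply: lerD.
    apply: le_trans (ler_normB _ _) _; rewrite !normrM (ger0_norm L0).
    by apply: lerD; rewrite ler_wpM2l.
  apply: le_trans (ler_norm_sum _ _ _) _; apply: ler_sum => k _.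
  have lk := gk_rate_gt0 (gk k).
  by rewrite normrM gtr0_norm // ler_pM2l.
set G := generator _ _ _ _ _ _ _ _ _ _ in GB.
rewrite -[X in `|X|](subrK ((t - s) * G)) [leRHS]mulrDl.
apply: le_trans (ler_normD _ _) _; apply: lerD.
  apply: le_trans (HC s t s0 st) _.
  by rewrite ler_wpM2l // expr2 ler_piMr.
by rewrite normrM (ger0_norm ts0) mulrC ler_wpM2r.
Qed.

Lemma is_derive_joint_density sigma (t : R) : 0 < t ->
  is_derive t 1 (fun s => joint_density P a X D sigma s phi)
    (generator P c lam a D X phi (derive1 phi) sigma t).
Proof.
have [M HM] := schwartz_bounded_upto Sphi 2.
have D1 := schwartz_is_derive Sphi 0; have D2 := schwartz_is_derive Sphi 1.
have [C HC] := generator_estimate a gk indep D1 D2 (HM 0%N isT) (HM 1%N isT)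
  (HM 2%N isT) sigma.
have [K HK] : unit_lipschitz (generator P c lam a D X phi (derive1 phi) sigma).
  apply: unit_lipschitzD; last first.
    apply: unit_lipschitz_sum => k; apply: unit_lipschitzZ.
    exact: (pairing_unit_lipschitz _ 0).
  apply: unit_lipschitzD; first exact/unit_lipschitzZ/(pairing_unit_lipschitz _ 1).
  have [K HK] := unit_lipschitzZ (- Lam) (pairing_unit_lipschitz sigma 0).
  by exists K => s u s0 su us1; have := HK s u s0 su us1; rewrite !mulNr.
apply: (is_derive_quadratic (C := C) (K := K)) => // s u s0 su.
have u0 := le_trans s0 (ltW su).
have cphi := is_derive_continuous D1.
rewrite (joint_density_pairing sigma s0 cphi (HM 0%N isT)).
rewrite (joint_density_pairing sigma u0 cphi (HM 0%N isT)).
exact: HC.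
Qed.

End TestFunction.

Lemma joint_density_telegraph_system :
  telegraph_system a c lam (joint_density P a X D).
Proof.
move=> sigma t t0 phi Sphi.
have [M HM] := schwartz_bounded_upto Sphi 1.
have D1 := schwartz_is_derive Sphi 0; have D2 := schwartz_is_derive Sphi 1.
have cphi := is_derive_continuous D1; have cdphi := is_derive_continuous D2.
have pE sig := joint_density_pairing sig (ltW t0) cphi (HM 0%N isT).
have pdE sig := joint_density_pairing sig (ltW t0) cdphi (HM 1%N isT).
have := is_derive_joint_density Sphi sigma t0.
rewrite /generator /dx mulrNN.
by rewrite pE pdE; under eq_bigr => k _ do rewrite -pE.
Qed.

End System.

Section Algebra.
Context (R : realType) (n : nat).
Variables a c lam : 'I_n -> R.

Lemma card_signs : #|{: signs n}| = (2 ^ n)%N.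
Proof. by rewrite card_ffun card_bool card_ord. Qed.

Lemma transport_mx_diag : transport_mx a c =
  diag_mx (\row_i c_sigma a c (enum_val i)).
Proof. by apply/matrixP => i j; rewrite !mxE. Qed.

Lemma transport_mx_hyperbolic : hyperbolic (transport_mx a c).
Proof.
by rewrite /hyperbolic transport_mx_diag; exact: diagonalizable_diag.
Qed.

Lemma telegraph_system_first_order (u : signs n -> R -> genfun R) :
  telegraph_system a c lam u <->
  first_order_system (transport_mx a c) (switching_mx lam)
    (fun i => u (enum_val i)).
Proof.
pose rhs sigma t : genfun R := fun phi =>
  - c_sigma a c sigma * dx (u sigma t) phi - lam_total lam * u sigma t phi
  + \sum_(k < n) lam k * u (flip sigma k) t phi.
have rhsE (i : 'I_#|{: signs n}|) t : (fun phi =>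
    - (\sum_j transport_mx a c i j * dx (u (enum_val j) t) phi)
    - \sum_j switching_mx lam i j * u (enum_val j) t phi) = rhs (enum_val i) t.
  apply/funext => phi; rewrite /rhs !mulNr -addrA; congr (_ + _).
    rewrite (bigD1 i) //= mxE eqxx mulr1n big1 ?addr0 // => j ji.
    by rewrite mxE eq_sym (negbTE ji) mulr0n mul0r.
  under eq_bigr => j _ do rewrite mxE mulrBl.
  rewrite sumrB opprB [LHS]addrC; congr (- _ + _).
    rewrite (bigD1 i) //= eqxx mulr1n big1 ?addr0 // => j ji.
    by rewrite eq_sym (negbTE ji) mulr0n mul0r.
  under eq_bigr => j _ do rewrite mulr_suml.
  rewrite exchange_big /=; apply: eq_bigr => k _.
  rewrite (bigD1 (enum_rank (flip (enum_val i) k))) //= enum_rankK eqxx mulr1n.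
  rewrite big1 ?addr0 // => j jk.
  case: eqP => [E|_]; last by rewrite mulr0n mul0r.
  by move: jk; rewrite E enum_valK eqxx.
split=> [H i t t0|H sigma t t0].
  by rewrite rhsE; exact: H.
have := H (enum_rank sigma) t t0; rewrite rhsE enum_rankK; exact.
Qed.

End Algebra.

Theorem theorem1 (d : measure_display) (T : measurableType d) (R : realType)
  (P : probability T R) (n : nat) (hn : (2 <= n)%N)
  (c lam x0 a : 'I_n -> R)
  (D0 : 'I_n -> T -> R) (N : 'I_n -> R -> T -> nat)
  (D X : 'I_n -> R -> T -> R)
  (hX : forall k, goldstein_kac P (c k) (lam k) (x0 k) (D0 k) (N k) (D k) (X k))
  (hindep : independent_telegraphs P D0 N)
  (ha : forall k, a k != 0) :
  telegraph_system a c lam (joint_density P a X D) /\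
  #|{: signs n}| = (2 ^ n)%N /\
  hyperbolic (transport_mx a c) /\
  (forall u : signs n -> R -> genfun R,
     telegraph_system a c lam u <->
     first_order_system (transport_mx a c) (switching_mx lam)
       (fun i => u (enum_val i))).
Proof.
split; first exact: joint_density_telegraph_system hX hindep.
split; first exact: card_signs.
split; first exact: transport_mx_hyperbolic.
exact: telegraph_system_first_order.
Qed.
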